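(* Let $d \geq 2$, let $\mathbb{F}_d$ be the free group on $d$ generators, and let $\mu$ be the probability measure on $\mathbb{F}_d$ that assigns mass $1/(2d)$ to each of the $d$ free generators and each of their inverses. Let $A \subseteq \mathbb{F}_d$ satisfy $\overline{\mathfrak{g}}(A) < \sqrt{2d-1}$. Then $A$ is $\mu$-light.
   Context: For $r \in \mathbb{N}$, $B_r \subset \mathbb{F}_d$ denotes the ball of radius $r$ around the identity in the standard word length metric given by the free generators. The upper exponential growth rate of $A \subseteq \mathbb{F}_d$ is $\overline{\mathfrak{g}}(A) = \limsup_{r\to\infty} |A \cap B_r|^{1/r}$. For a group $\Gamma$ with a finitely supported probability measure $\mu$, a function $f \colon \Gamma \to \mathbb{R}$ is (left) $\mu$-harmonic if $f(g) = \sum_{h \in \Gamma} \mu(h) f(h^{-1}g)$ for all $g \in \Gamma$. A subset $A \subseteq \Gamma$ is $\mu$-light if there exists a (strictly) positive left $\mu$-harmonic function $f\colon\Gamma\to\mathbb{R}$ such that $\sum_{g \in A} f(g) < \infty$. (For nonempty $A$ this is equivalent to the existence of a countably additive measure $M$ on $\Gamma$ with $\sum_{g}\mu(g) M(g^{-1}E) = M(E)$ for all $E \subseteq \Gamma$ and $M(A) = 1$.) *)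

(* Defs.v *)
From HB Require Import structures.
From mathcomp Require Import all_boot all_order all_algebra finmap.
From mathcomp Require Import all_classical all_reals all_analysis.

Set Implicit Arguments.
Unset Strict Implicit.
Unset Printing Implicit Defensive.

Import Order.TTheory GRing.Theory Num.Theory.

Local Open Scope classical_set_scope.
Local Open Scope ring_scope.

(* The free group on d generators, as the group of reduced words.
   The letter (i, true) stands for the i-th generator, (i, false) for its
   inverse. *)
Definition letter (d : nat) : Type := ('I_d * bool)%type.
HB.instance Definition _ d := Finite.on (letter d).

Definition linv d (x : letter d) : letter d := (x.1, ~~ x.2).

Definition reduced d (w : seq (letter d)) : bool :=
  sorted (fun x y => y != linv x) w.

Record free_group (d : nat) :=
  FreeGroup { fword : seq (letter d); _ : reduced fword }.

HB.instance Definition _ d := [isSub for @fword d].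
HB.instance Definition _ d := [Countable of free_group d by <:].

(* Left multiplication of a reduced word by one letter. *)
Definition lcons d (x : letter d) (w : seq (letter d)) : seq (letter d) :=
  if w is y :: w' then if y == linv x then w' else x :: w else [:: x].

Definition wmul d (u v : seq (letter d)) : seq (letter d) :=
  foldr (@lcons d) v u.

Definition winv d (u : seq (letter d)) : seq (letter d) :=
  rev (map (@linv d) u).

Section FreeGroupLaws.
Variable d : nat.
Implicit Types (x y : letter d) (u v w : seq (letter d)).

Lemma linvK : involutive (@linv d).
Proof. by case=> i b; rewrite /linv /= negbK. Qed.

Lemma reduced_lcons x w : reduced w -> reduced (lcons x w).
Proof.
case: w => //= y w; case: ifP => [_|/negbT nyx]; last by move=> /= ->; rewrite nyx.
by move/path_sorted.
Qed.

Lemma reduced_wmul u v : reduced v -> reduced (wmul u v).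
Proof. by move=> rv; elim: u => //= x u; exact: reduced_lcons. Qed.

Lemma reduced_winv u : reduced u -> reduced (winv u).
Proof.
rewrite /reduced /winv rev_sorted sorted_map => ru.
apply: sub_sorted ru => x y; rewrite /relpre /= => nyx.
by rewrite linvK eq_sym.
Qed.

Lemma lconsK x w : reduced w -> lcons x (lcons (linv x) w) = w.
Proof.
case: w => [|y w] /=; first by rewrite eqxx.
rewrite linvK; case: eqP => [->|_ _] /=; last by rewrite eqxx.
by case: w => //= z w /andP[/negbTE ->].
Qed.

Lemma wmul_lcons x u w : reduced w -> wmul (lcons x u) w = lcons x (wmul u w).
Proof.
move=> rw; case: u => //= y u; case: eqP => // ->.
by rewrite lconsK ?reduced_wmul.
Qed.

Lemma wmulA u v w : reduced w -> wmul u (wmul v w) = wmul (wmul u v) w.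
Proof. by move=> rw; elim: u => //= x u ->; rewrite wmul_lcons. Qed.

Lemma wmuls0 u : reduced u -> wmul u [::] = u.
Proof.
rewrite /reduced; elim: u => //= x u IHu ru; rewrite IHu ?(path_sorted ru) //.
by case: u ru {IHu} => //= y u /andP[/negbTE -> _].
Qed.

Lemma wmulVs u w : reduced w -> wmul (winv u) (wmul u w) = w.
Proof.
elim: u w => //= x u IHu w rw.
rewrite /winv map_cons rev_cons /wmul -cats1 foldr_cat /=.
by rewrite -{2}[x]linvK lconsK ?reduced_wmul //; exact: IHu.
Qed.

Lemma winvK : involutive (@winv d).
Proof.
move=> u; rewrite /winv map_rev revK -map_comp map_id_in // => x _.
exact: linvK.
Qed.

Let fmul (g h : free_group d) : free_group d :=
  FreeGroup (reduced_wmul (val g) (valP h)).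
Let fone : free_group d := @FreeGroup d [::] isT.
Let finv (g : free_group d) : free_group d :=
  FreeGroup (reduced_winv (valP g)).

Let fmulA : associative fmul.
Proof. by move=> f g h; apply: val_inj; apply: wmulA (valP h). Qed.
Let fmul1 : left_id fone fmul.
Proof. by move=> g; apply: val_inj. Qed.
Let fmulr1 : right_id fone fmul.
Proof. by move=> g; apply: val_inj; apply: wmuls0 (valP g). Qed.
Let fmulV : left_inverse fone finv fmul.
Proof.
move=> g; apply: val_inj => /=.
by rewrite -{2}(wmuls0 (valP g)) wmulVs.
Qed.
Let fmulrV : right_inverse fone finv fmul.
Proof.
move=> g; rewrite -[X in fmul X _](_ : finv (finv g) = g) ?fmulV //.
by apply: val_inj; apply: winvK.
Qed.

HB.instance Definition _ :=
  isGroup.Build (free_group d) fmulA fmul1 fmulr1 fmulV fmulrV.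

End FreeGroupLaws.

Definition gen d (i : 'I_d) : free_group d := @FreeGroup d [:: (i, true)] isT.

(* The ball of radius r around 1 for the word metric of the group G with
   respect to the set of generators S. *)
Definition word_ball (G : groupType) (S : set G) (r : nat) : set G :=
  [set g | exists s : seq G, [/\ (size s <= r)%N,
     (forall x, x \in s -> S x \/ S (x^-1)%g)
     & g = (\prod_(x <- s) x)%g]].

Definition fball (d r : nat) : set (free_group d) :=
  word_ball (range (@gen d)) r.

(* By fball_finite below, fset_set gives the actual cardinality here. *)
Definition upper_growth (R : realType) d (A : set (free_group d)) : \bar R :=
  limn_esup (fun r : nat =>
    ((#|`fset_set (A `&` fball r)|)%:R `^ (r%:R)^-1)%:E).

Definition is_finprob (R : realType) (G : groupType) (mu : G -> R) : Prop :=
  [/\ forall g, 0 <= mu g, finite_set [set g | mu g != 0]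
    & \sum_(g \in [set: G]) mu g = 1].

(* The \sum_(_ \in _) below ranges over the support of the summand, which is
   finite whenever is_finprob mu (it would be 0 if the support were infinite). *)
Definition mu_harmonic (R : realType) (G : groupType) (mu f : G -> R) : Prop :=
  forall g : G, f g = \sum_(h \in [set: G]) (mu h * f (h^-1 * g)%g).

Definition mu_light (R : realType) (G : groupType) (mu : G -> R) (A : set G) :
    Prop :=
  exists f : G -> R, [/\ forall g, 0 < f g, mu_harmonic mu f
    & (\esum_(g in A) (f g)%:E < +oo)%E].

(* The step distribution of the simple random walk; for 0 < d the 2d letters
   are pairwise distinct and this is a probability measure (srw_finprob). *)
Definition srw (R : realType) (d : nat) (g : free_group d) : R :=
  if `[< exists i : 'I_d, g = gen i \/ g = (gen i)^-1%g >]
  then ((2 * d)%:R)^-1 else 0.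

Lemma word_ball_finite (G : groupType) (S : set G) (r : nat) :
  finite_set S -> finite_set (word_ball S r).
Proof.
move=> finS; pose T := S `|` (fun x : G => x^-1)%g @` S.
have finT : finite_set T by rewrite finite_setU; split=> //; exact: finite_image.
elim: r => [|r IHr].
  apply: (sub_finite_set _ (finite_set1 (1%g : G))) => g [s []].
  by case: s => //= _ _ ->; rewrite big_nil.
apply: (@sub_finite_set _ _ ([set 1%g] `|`
  (fun p : G * G => p.1 * p.2)%g @` (T `*` word_ball S r))); last first.
  by rewrite finite_setU; split=> //; apply/finite_image/finite_setX.
move=> g [[|x s] [/= sz sS ->]]; first by left; rewrite /= big_nil.
right; exists (x, \prod_(y <- s) y)%g => /=; last by rewrite big_cons.
split=> /=.
  case: (sS x (mem_head x s)) => Sx; [by left|right].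
  by exists (x^-1)%g => //; rewrite invgK.
by exists s; split=> // y ys; apply: sS; rewrite inE ys orbT.
Qed.

Lemma fball_finite (d r : nat) : finite_set (@fball d r).
Proof. by apply: word_ball_finite; apply: finite_image; exact: finite_finset. Qed.

Lemma srw_finprob (R : realType) (d : nat) :
  (0 < d)%N -> is_finprob (@srw R d).
Proof.
move=> d0.
pose F (x : letter d) : free_group d := @FreeGroup d [:: x] isT.
have Fgen i : F (i, true) = gen i by apply: val_inj.
have FgenV i : F (i, false) = (gen i)^-1%g by apply: val_inj.
have injF : injective F by move=> x y [].
have srwF x : srw R (F x) = ((2 * d)%:R)^-1.
  by rewrite /srw asboolT//; case: x => i []; exists i; [left|right].
have srw0 g : ~ range F g -> srw R g = 0.
  move=> nFg; rewrite /srw asboolF// => -[i [] gE]; apply: nFg.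
    by exists (i, true); rewrite // gE Fgen.
  by exists (i, false); rewrite // gE FgenV.
split.
- by move=> g; rewrite /srw; case: ifP; rewrite // invr_ge0.
- apply: (@sub_finite_set _ _ (range F)); last exact/finite_image/finite_finset.
  by move=> g /eqP ng0; apply: contrapT => /srw0.
rewrite -(fsbig_widen (range F)) //; last by move=> g [_] /srw0.
rewrite (reindex_fsbig F [set: letter d] (range F)) /=; last first.
  by split=> //; exact: in2W.
rewrite (eq_fsbigr (fun=> ((2 * d)%:R)^-1)); last by move=> x _; exact: srwF.
rewrite (_ : [set: letter d] = [set` enum {: letter d}]); last first.
  by apply/seteqP; split=> x //= _; rewrite mem_enum.
rewrite -fsbig_seq ?enum_uniq // big_const_seq count_predT -cardE iter_addr_0.
rewrite card_prod card_ord card_bool (mulnC d) -[LHS]mulr_natl mulfV //.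
by rewrite pnatr_eq0 muln_eq0 -lt0n d0.
Qed.

(* Main.v *)
(* With q = 2d - 1, let xi be an end of the tree and let c(g) be the length of
   the common suffix of g and xi. The Martin kernel K(g) = q^(2 c(g) - |g|) is
   positive and harmonic, so it suffices to find xi with K summable over A. For
   a uniformly random xi the expectation of sqrt (K(g)) is of order
   (1 + |g|) q^(-|g|/2), which is summable over A when A grows more slowly than
   sqrt q; hence sqrt K, and a fortiori K, is summable over A for some xi.
   The random choice is derandomized: a supermartingale bounding the
   conditional expectation of sqrt (K(g)), summed over g in A, does not increase
   along some sequence of one-letter extensions, which defines xi. *)
Require Import Defs.
From HB Require Import structures.
From mathcomp Require Import all_boot all_order all_algebra finmap.
From mathcomp Require Import all_classical all_reals all_analysis.
From mathcomp Require Import ring lra zify.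

Import Order.TTheory GRing.Theory Num.Theory.

Local Open Scope classical_set_scope.
Local Open Scope ring_scope.

Set Implicit Arguments.
Unset Strict Implicit.
Unset Printing Implicit Defensive.

(** * Common suffixes and the supermartingale *)

Lemma suffix_cons_r (T : eqType) (x : T) (s w : seq T) :
  suffix s (x :: w) = (s == x :: w) || suffix s w.
Proof.
apply/idP/orP.
  case/suffixP=> -[|y u] [].
    by move=> ->; left.
  by move=> _ ->; right; apply: suffix_suffix.
case=> [/eqP->|]; first exact: suffix_refl.
move=> /suffixP[u ->]; apply/suffixP; by exists (x :: u).
Qed.

(* The length of the longest common suffix: one nonempty suffix of g is counted
   for each length up to it. *)
Fixpoint common_suffix (T : eqType) (w g : seq T) : nat :=
  if g is _ :: g' then (suffix g w + common_suffix w g')%N else 0.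

(** The only suffix of [x :: w] that is not one of [w] is [x :: w] itself. *)
Lemma common_suffix_cons (T : eqType) (x : T) (w g : seq T) :
  common_suffix (x :: w) g = (common_suffix w g + suffix (x :: w) g)%N.
Proof.
elim: g => [|y g IHg] /=; first by rewrite suffixs0.
rewrite {}IHg !suffix_cons_r.
have -> : (x :: w == y :: g) = (y :: g == x :: w) by rewrite eq_sym.
have [e|_] := eqVneq (y :: g) (x :: w); last by rewrite /= addnA.
have -> : suffix (y :: g) w = false.
  by apply/negP; rewrite e => /size_suffix /=; rewrite ltnn.
case: e => _ ->.
have -> : suffix (x :: w) w = false.
  by apply/negP => /size_suffix /=; rewrite ltnn.
lia.
Qed.

(* With p = sqrt q: a bound for the conditional expectation of sqrt (K(g)) given
   that the random end xi has suffix w. Multiplication acts on the left end of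
   words, so ends are read from the right. Each of the |g| - |w| + 1 levels at
   which xi can leave g contributes at most
   q^(common_suffix w g) / sqrt q^|g| to the expectation, whence the second
   factor. *)
Definition potential (R : realType) (T : eqType) (p : R) (w g : seq T) : R :=
  p ^+ (2 * common_suffix w g) / p ^+ size g *
  (if suffix w g then (size g - size w).+1%:R else 1).

Lemma potential_ge0 (R : realType) (T : eqType) (p : R) (w g : seq T) :
  0 <= p -> 0 <= potential p w g.
Proof.
move=> p0; rewrite /potential mulr_ge0 ?divr_ge0 ?exprn_ge0 //.
by case: ifP.
Qed.

Lemma sum_delta_le (R : realType) (T : finType) (P : pred T) (y : T) (c : R) :
  0 <= c -> \sum_(x | P x) (if x == y then c else 0) <= c.
Proof.
move=> c0; rewrite -big_mkcondr /=.
have [Py|nPy] := boolP (P y).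
  by rewrite (big_pred1 y) // => x /=; case: eqP => [->|]; rewrite ?Py ?andbF.
rewrite big_pred0 // => x; case: eqP => [->|]; rewrite ?andbF //.
by rewrite (negbTE nPy).
Qed.

(** The supermartingale step. If [w] is a suffix of [g] with n > 0 letters to go, at most one [x]
    prolongs the match: it turns K (n + 1) into K p^2 n, and every other [x] gives K. As p^2 is at
    most the number of choices, the total is at most K (n + 1) per choice. In the other cases no [x]
    prolongs the match. *)
Lemma sum_potential_le (R : realType) (T : finType) (p : R) (P : pred T)
    (w g : seq T) :
  0 < p -> p ^+ 2 <= #|P|%:R ->
  \sum_(x | P x) potential p (x :: w) g <= \sum_(x | P x) potential p w g.
Proof.
move=> p0 pP; rewrite [leRHS]sumr_const.
have K0 : 0 <= p ^+ (2 * common_suffix w g) / p ^+ size g.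
  by rewrite divr_ge0 ?exprn_ge0 // ltW.
set K := _ / _ in K0.
have [wg|wg] := boolP (suffix w g); last first.
  rewrite [leLHS](eq_bigr (fun=> potential p w g)) ?sumr_const // => x _.
  rewrite /potential common_suffix_cons (negbTE wg).
  have -> : suffix (x :: w) g = false.
    by apply: contraNF wg; apply: suffix_trans; exact: suffix_cons.
  by rewrite addn0.
have /suffixP[u gE] := wg.
have -> : potential p w g = K * (size u).+1%:R.
  rewrite /potential wg (_ : size g - size w = size u)%N //.
  by rewrite gE size_cat addnK.
case/lastP: u gE => [|u y] gE.
  rewrite [leLHS](eq_bigr (fun=> K * 1)) ?sumr_const // => x _.
  rewrite /potential common_suffix_cons.
  have -> : suffix (x :: w) g = false.
    by apply/negP; rewrite gE => /size_suffix /=; rewrite ltnn.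
  by rewrite addn0.
have sE x : suffix (x :: w) g = (x == y).
  by rewrite gE -cats1 -catA -[x :: w]cat0s suffix_catl // eqseq_cons eqxx
    suffix0s !andbT.
apply: (@le_trans _ _ (\sum_(x | P x)
    (K + (if x == y then K * (p ^+ 2 * (size u).+1%:R) else 0)))).
  apply: ler_sum => x _; rewrite /potential common_suffix_cons sE.
  case: eqP => _; last by rewrite addn0 mulr1 addr0.
  rewrite mulnDr exprD /= muln1.
  rewrite (_ : (size g - (size w).+1).+1 = (size u).+1); last first.
    by rewrite gE size_cat size_rcons addSnnS addnK.
  rewrite [p ^+ _ * _]mulrC -(mulrA (p ^+ 2)) -/K mulrAC.
  rewrite [_ * K]mulrC lerDr //.
rewrite big_split /= sumr_const.
apply: (le_trans (lerD (lexx _) (sum_delta_le P y _))).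
  by rewrite mulr_ge0 // mulr_ge0 // exprn_ge0 // ltW.
rewrite size_rcons -[(size u).+2%:R]natr1 mulrDr mulr1 mulrnDl addrC lerD2r.
by rewrite -mulrnAr ler_wpM2l // -[leRHS]mulr_natl ler_wpM2r.
Qed.

(** * Choice of the end by averaging *)

Lemma esum_descent (R : realType) (T : choiceType) (I : finType) (P : pred I)
    (A : set T) (a : I -> T -> R) (b : T -> R) (i0 : I) :
  P i0 -> (forall i t, 0 <= a i t) -> (forall t, 0 <= b t) ->
  (forall t, \sum_(i | P i) a i t <= \sum_(i | P i) b t) ->
  (\esum_(t in A) (b t)%:E < +oo)%E ->
  exists i, P i /\ (\esum_(t in A) (a i t)%:E <= \esum_(t in A) (b t)%:E)%E.
Proof.
move=> Pi0 a0 b0 ab bfin; apply: contrapT => noi.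
have gt i : P i -> (\esum_(t in A) (b t)%:E < \esum_(t in A) (a i t)%:E)%E.
  by move=> Pi; rewrite ltNge; apply/negP => le; apply: noi; exists i.
have : (\sum_(i | P i) \esum_(t in A) (a i t)%:E <=
        \sum_(i | P i) \esum_(t in A) (b t)%:E)%E.
  rewrite -!esum_sum; try by move=> *; rewrite lee_fin.
  by apply: le_esum => t _; rewrite !sumEFin lee_fin.
(* The strict inequality at [i0] survives adding the other indices because the sums of [b] are
   finite. *)
apply/negP; rewrite -ltNge (bigD1 i0) //= [ltRHS](bigD1 i0) //=.
apply: lte_leD; last 2 first.
- exact: gt.
- by apply: lee_sum => i /andP[Pi _]; exact/ltW/gt.
apply/sum_fin_numP => i _ _; rewrite ge0_fin_numE //.
by apply: esum_ge0 => t _; rewrite lee_fin.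
Qed.

Lemma card_letter d : #|{: letter d}| = (2 * d)%N.
Proof. by rewrite card_prod card_ord card_bool mulnC. Qed.

(** At most one letter is excluded, the inverse of the first letter of [w]. *)
Lemma card_extensions d (w : seq (letter d)) : reduced w ->
  (2 * d - 1 <= #|[pred x | reduced (x :: w)]|)%N.
Proof.
case: w => [|y w] rw.
  rewrite (eq_card (_ : _ =i predT)) ?card_letter ?leq_subr // => x.
rewrite -card_letter -(cardC (pred1 (linv y))) card1 add1n subn1 /=.
apply/subset_leq_card/fintype.subsetP => x; rewrite !inE /= => xy.
move: rw; rewrite /reduced /= => ->; rewrite andbT; apply: contra xy => /eqP ->.
by rewrite linvK.
Qed.

Lemma potential_descent (R : realType) d (p : R) (A : set (free_group d))
    (w : seq (letter d)) :
  (0 < d)%N -> 0 < p -> p ^+ 2 = (2 * d - 1)%:R -> reduced w ->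
  (\esum_(g in A) (potential p w (val g))%:E < +oo)%E ->
  exists x, reduced (x :: w) /\
    (\esum_(g in A) (potential p (x :: w) (val g))%:E <=
     \esum_(g in A) (potential p w (val g))%:E)%E.
Proof.
move=> d0 p0 pE rw; have card := card_extensions rw.
have /card_gt0P[x0 Px0] : (0 < #|[pred x | reduced (x :: w)]|)%N.
  by apply: leq_trans card; lia.
apply: (esum_descent (P := [pred x | reduced (x :: w)]) Px0).
- by move=> x g; exact/potential_ge0/ltW.
- by move=> g; exact/potential_ge0/ltW.
- by move=> g; apply: sum_potential_le => //; rewrite pE ler_nat.
Qed.

Lemma exists_ray (R : realType) d (p : R) (A : set (free_group d)) :
  (0 < d)%N -> 0 < p -> p ^+ 2 = (2 * d - 1)%:R ->
  (\esum_(g in A) (potential p [::] (val g))%:E < +oo)%E ->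
  exists xi : nat -> seq (letter d),
    [/\ forall n, reduced (xi n), forall n, size (xi n) = n,
        forall n, suffix (xi n) (xi n.+1) &
        forall n, (\esum_(g in A) (potential p (xi n) (val g))%:E <=
                   \esum_(g in A) (potential p [::] (val g))%:E)%E].
Proof.
move=> d0 p0 pE fin0.
pose Phi w := (\esum_(g in A) (potential p w (val g))%:E)%E.
(* The hypotheses sit under the existential so that [next] is total; where they fail its value is
   arbitrary. *)
have /choice[next nextP] (w : seq (letter d)) : exists x,
    reduced w -> (Phi w < +oo)%E ->
    reduced (x :: w) /\ (Phi (x :: w) <= Phi w)%E.
  have [[rw fw]|nw] := pselect (reduced w /\ (Phi w < +oo)%E).
    by have [x] := potential_descent d0 p0 pE rw fw; exists x.
  by exists (Ordinal d0, true) => rw fw; case: nw.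
pose xi n := iter n (fun w => next w :: w) [::].
have xiP n : reduced (xi n) /\ (Phi (xi n) <= Phi [::])%E.
  elim: n => //= n [rn len]; have [rS leS] := nextP _ rn (le_lt_trans len fin0).
  by split=> //; exact: le_trans len.
exists xi; split=> n.
- by case: (xiP n).
- by elim: n => //= n ->.
- exact: suffix_cons.
- by case: (xiP n).
Qed.

(** * Harmonicity of the Martin kernel *)

(* This is q^(2 c(g) - |g|) when w is a suffix of xi with size g <= size w. *)
Definition kernel (R : realType) (T : eqType) (q : R) (w g : seq T) : R :=
  q ^+ (2 * common_suffix w g) / q ^+ size g.

(* Exactly one neighbour, the one indexed by z, lies towards the end. *)
Lemma kernel_lcons (R : realType) d (q : R) (w g : seq (letter d)) :
  0 < q -> reduced w -> (size g < size w)%N ->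
  exists z, forall x, kernel q w (lcons x g) =
    kernel q w g * (if x == z then q else q^-1).
Proof.
move=> q0 rw gw; have qn0 : q != 0 by rewrite gt_eqF.
have kcons x h : kernel q w (x :: h) =
    kernel q w h * (if suffix (x :: h) w then q else q^-1).
  rewrite /kernel /=; case: ifP => _.
    rewrite mulnDr exprD exprS; field.
    by rewrite qn0 expf_neq0.
  by rewrite add0n exprS invfM [q^-1 * _]mulrC mulrA.
(* On the ray, the neighbour towards the end prolongs the match. Cancelling the first letter of [g]
   is a different move because [w] is reduced. *)
have [gsw|gsw] := boolP (suffix g w).
  have /suffixP[u wE] := gsw.
  case/lastP: u wE => [|u z] wE; first by move: gw; rewrite wE ltnn.
  have sE x : suffix (x :: g) w = (x == z).
    by rewrite wE -cats1 -catA -[x :: g]cat0s suffix_catl // eqseq_cons eqxx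
      suffix0s !andbT.
  exists z => x; case: g gsw gw wE sE => [|y g] gsw gw wE sE /=.
    by rewrite kcons sE.
  case: ifP => [yx|_]; last by rewrite kcons sE.
  have -> : (x == z) = false.
    apply/negP => /eqP xz; move: rw; rewrite /reduced wE -cats1 -catA.
    by case/cat_sorted2 => _ /=; rewrite -xz yx.
  by rewrite kcons gsw mulfK.
(* Off the ray, one moves towards the end by cancelling the first letter. *)
case: g gsw gw => [|y g] gsw gw; first by rewrite suffix0s in gsw.
exists (linv y) => x /=; rewrite -(inj_eq (inv_inj (@linvK d))) linvK eq_sym.
case: ifP => _; first by rewrite kcons (negbTE gsw) mulfVK.
rewrite kcons ifF //; apply: contraNF gsw.
by apply: suffix_trans; exact: suffix_cons.
Qed.

(** One neighbour contributes the factor q and the other q neighbours 1/q each: q + 1 = 2d in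
    total. *)
Lemma sum_kernel_lcons (R : realType) d (w g : seq (letter d)) :
  (0 < d)%N -> reduced w -> (size g < size w)%N ->
  \sum_x kernel ((2 * d - 1)%:R : R) w (lcons x g) =
  (2 * d)%:R * kernel (2 * d - 1)%:R w g.
Proof.
move=> d0 rw gw; set q : R := (2 * d - 1)%:R.
have q0 : 0 < q by rewrite ltr0n; lia.
have [z zP] := kernel_lcons q0 rw gw.
rewrite (eq_bigr _ (fun x _ => zP x)) -mulr_sumr mulrC; congr (_ * _).
rewrite (bigD1 z) //= eqxx (eq_bigr (fun=> q^-1)); last first.
  by move=> x /negbTE ->.
rewrite sumr_const (_ : #|_| = (2 * d - 1)%N); last first.
  by rewrite -card_letter -(cardC (pred1 z)) card1 add1n subn1.
rewrite -[_ *+ _]mulr_natl mulfV ?gt_eqF // natr1; congr _%:R; lia.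
Qed.

(** Words longer than [g] are not suffixes of it, so any long enough piece of the ray determines the
    kernel at [g]. *)
Lemma common_suffix_stable (T : eqType) (w w' g : seq T) :
  suffix w w' -> (size g <= size w)%N ->
  common_suffix w' g = common_suffix w g.
Proof.
case/suffixP=> u -> gw; elim: u => //= x u IHu.
rewrite common_suffix_cons IHu (_ : suffix _ g = false) ?addn0 //.
by apply/negP => /size_suffix /=; rewrite size_cat; lia.
Qed.

Lemma sum_srw (R : realType) d (phi : free_group d -> R) :
  \sum_(h \in [set: free_group d]) (srw R h * phi h) =
  (2 * d)%:R^-1 * \sum_x phi (@FreeGroup d [:: x] isT).
Proof.
pose F (x : letter d) : free_group d := @FreeGroup d [:: x] isT.
have Fgen i : F (i, true) = gen i by apply: val_inj.
have FgenV i : F (i, false) = (gen i)^-1%g by apply: val_inj.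
have injF : injective F by move=> x y [].
have srwF x : srw R (F x) = ((2 * d)%:R)^-1.
  by rewrite /srw asboolT//; case: x => i []; exists i; [left|right].
have srw0 g : ~ range F g -> srw R g = 0.
  move=> nFg; rewrite /srw asboolF// => -[i [] gE]; apply: nFg.
    by exists (i, true); rewrite // gE Fgen.
  by exists (i, false); rewrite // gE FgenV.
rewrite -(fsbig_widen (range F)) //; last first.
  by move=> g [_] /srw0 /= ->; rewrite mul0r.
rewrite (reindex_fsbig F [set: letter d] (range F)) /=; last first.
  by split=> //; exact: in2W.
rewrite (eq_fsbigr (fun x => (2 * d)%:R^-1 * phi (F x))); last first.
  by move=> x _; rewrite srwF.
rewrite (_ : [set: letter d] = [set` enum {: letter d}]); last first.
  by apply/seteqP; split=> x //= _; rewrite mem_enum.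
by rewrite -fsbig_seq ?enum_uniq // big_enum /= mulr_sumr.
Qed.

Lemma kernel_harmonic (R : realType) d (xi : nat -> seq (letter d)) :
  (0 < d)%N -> (forall n, reduced (xi n)) -> (forall n, size (xi n) = n) ->
  (forall m n, (m <= n)%N -> suffix (xi m) (xi n)) ->
  mu_harmonic (@srw R d)
    (fun g => kernel (2 * d - 1)%:R (xi (size (val g))) (val g)).
Proof.
(* Neighbours of [g] have length at most [N], so the single word [xi N] serves for all of them and
   for [g]. *)
move=> d0 rxi sxi xixi g; pose N := (size (val g)).+1.
have stable h : (size h <= N)%N ->
    kernel (2 * d - 1)%:R (xi (size h)) h = kernel (2 * d - 1)%:R (xi N) h :> R.
  move=> hN; rewrite /kernel (common_suffix_stable (xixi _ _ hN)) //.
  by rewrite sxi.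
(* Inverting the letters turns h^-1 g into [lcons x g]. *)
rewrite sum_srw (reindex_inj (inv_inj (@linvK d))) /=.
rewrite (eq_bigr (fun x => kernel (2 * d - 1)%:R (xi N) (lcons x (val g)))).
  rewrite sum_kernel_lcons ?sxi // mulKf ?stable //.
  by rewrite pnatr_eq0; lia.
move=> x _; rewrite linvK stable //.
by rewrite /N /=; case: (fword g) => //= y v; case: ifP => //= _; lia.
Qed.

(** * Growth and summability of the initial potential *)

Lemma mem_fball d (g : free_group d) (r : nat) :
  (size (val g) <= r)%N -> fball r g.
Proof.
move=> gr; pose F (x : letter d) : free_group d := @FreeGroup d [:: x] isT.
have valprod s : reduced s -> val (\prod_(x <- map F s) x)%g = s.
  elim: s => [|x s IHs] rs /=; first by rewrite big_nil.
  rewrite big_cons /= [fword _]IHs; last exact: path_sorted rs.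
  by case: s rs {IHs} => //= y s; rewrite /reduced /= => /andP[/negbTE -> _].
exists (map F (val g)); split; first by rewrite size_map.
- move=> _ /mapP[[i []] _ ->]; [left|right]; exists i => //; exact: val_inj.
- by apply: val_inj; rewrite valprod //; exact: valP g.
Qed.

Lemma upper_growth_bound (R : realType) d (A : set (free_group d)) (p : R) :
  (upper_growth R A < p%:E)%E ->
  exists s C : R, [/\ 0 < s, s < p, 0 <= C &
    forall r, #|` fset_set (A `&` fball r)|%:R <= C * s ^+ r].
Proof.
rewrite /upper_growth limn_esup_lim; set u := (X in esups X).
rewrite (cvg_lim _ (@cvg_esups_inf _ u)) // => /ereal_inf_lt[_ [n0 _ <-]] lt.
pose a r : R := #|` fset_set (A `&` fball r)|%:R.
have ule r : (n0 <= r)%N -> (u r <= esups u n0)%E.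
  by move=> nr; apply: ereal_sup_ubound; exists r.
have fin : esups u n0 \is a fin_num.
  rewrite ge0_fin_numE ?(lt_trans lt) ?ltry //.
  by apply: le_trans (ule _ (leqnn n0)); rewrite lee_fin powR_ge0.
pose s0 := fine (esups u n0).
have s0E : esups u n0 = s0%:E by rewrite fineK.
have s0p : s0 < p by rewrite s0E lte_fin in lt.
have au r : (n0 <= r)%N -> a r `^ (r%:R)^-1 <= s0.
  by move=> /ule; rewrite s0E lee_fin.
have s00 : 0 <= s0 by apply: le_trans (au _ (leqnn n0)); exact: powR_ge0.
(* The midpoint stays positive even when [s0] is 0. *)
pose s := (s0 + p) / 2.
have s_gt0 : 0 < s by rewrite /s; lra.
(* Strictness excludes r = 0, where the exponent 1/r is 0 and the root cannot be undone. *)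
have as_ r : (n0 < r)%N -> a r <= s ^+ r.
  move=> nr; have r0 : r%:R != 0 :> R by rewrite pnatr_eq0; lia.
  have -> : a r = (a r `^ (r%:R)^-1) ^+ r.
    by rewrite -powR_mulrn ?powR_ge0 // -powRrM mulVf // powRr1.
  apply: lerXn2r; rewrite ?nnegrE ?powR_ge0 ?(ltW s_gt0) //.
  by apply: le_trans (au r (ltnW nr)) _; rewrite /s; lra.
(* The sum absorbs the radii up to [n0], the 1 all larger ones. *)
pose C := 1 + \sum_(r < n0.+1) a r / s ^+ r.
have S0 : 0 <= \sum_(r < n0.+1) a r / s ^+ r.
  by apply: sumr_ge0 => r _; rewrite divr_ge0 // exprn_ge0 // ltW.
exists s, C; split=> //; first by rewrite /s; lra.
  by rewrite /C addr_ge0.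
move=> r; have sr : 0 < s ^+ r by rewrite exprn_gt0.
have [rn|nr] := ltnP r n0.+1; last first.
  by apply: le_trans (as_ r nr) _; rewrite ler_peMl ?(ltW sr) // /C lerDl.
rewrite -ler_pdivrMr // /C (bigD1 (Ordinal rn)) //= addrCA lerDl.
rewrite addr_ge0 // sumr_ge0 // => i _.
by rewrite divr_ge0 // exprn_ge0 // ltW.
Qed.

(** These are partial sums of the derivative of the geometric series; multiplied by (1 - t)^2 they
    become 1 minus a nonnegative remainder. *)
Lemma sum_arith_geom_le (R : realType) (t : R) (n : nat) : 0 <= t -> t < 1 ->
  \sum_(r < n) r.+1%:R * t ^+ r <= (1 - t) ^- 2.
Proof.
move=> t0 t1; have t2 : 0 < (1 - t) ^+ 2 by rewrite exprn_gt0 // subr_gt0.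
rewrite -[leRHS]mul1r ler_pdivlMr //.
have -> : (\sum_(r < n) r.+1%:R * t ^+ r) * (1 - t) ^+ 2 =
    1 - t ^+ n * (1 + n%:R * (1 - t)).
  elim: n => [|n IHn]; first by rewrite big_ord0 expr0; ring.
  by rewrite big_ord_recr /= mulrDl IHn [t ^+ n.+1]exprS -natr1; ring.
rewrite lerBlDr lerDl mulr_ge0 ?exprn_ge0 // addr_ge0 // mulr_ge0 //.
by rewrite subr_ge0 ltW.
Qed.

(** At the empty word the potential is (|g| + 1) / p^|g|, so a growth bound C s^r with s < p reduces
    the sum to an arithmetic-geometric series in s/p. *)
Lemma potential_nil_esum (R : realType) d (A : set (free_group d)) (p : R) :
  0 < p -> (upper_growth R A < p%:E)%E ->
  (\esum_(g in A) (potential p [::] (val g))%:E < +oo)%E.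
Proof.
move=> p0 /upper_growth_bound[s [C [s0 sp C0 aC]]].
pose b r : R := r.+1%:R / p ^+ r.
have b0 r : 0 <= b r by rewrite divr_ge0 // exprn_ge0 // ltW.
have potE w : potential p [::] w = b (size w) :> R.
  rewrite /potential suffix0s subn0 /b mulrC; congr (_ * _).
  suff -> : common_suffix [::] w = 0%N by rewrite expr0 div1r.
  by elim: w => //= x w ->; rewrite suffixs0.
apply: (@le_lt_trans _ _ (C * (1 - s / p) ^- 2)%:E); last exact: ltry.
apply: ge_ereal_sup => _ [X [Xfin XA] <-].
rewrite fsbig_finite // sumEFin lee_fin.
pose N := (\max_(g <- fset_set X) size (val g)).+1.
have XN g : g \in fset_set X -> (size (val g) < N)%N.
  by move=> gX; rewrite ltnS (leq_bigmax_seq (F := fun g => size (val g)) g).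
(* Each term b |g| is one of the terms b r with |g| <= r, so that only the
   cardinals of balls, not of spheres, enter the bound. *)
apply: (@le_trans _ _ (\sum_(g <- fset_set X) \sum_(r < N)
    (if (size (val g) <= r)%N then b r else 0))).
  rewrite big_seq [leRHS]big_seq; apply: ler_sum => g gX.
  rewrite potE (bigD1 (Ordinal (XN g gX))) //= leqnn lerDl.
  by apply: sumr_ge0 => r _; case: ifP.
rewrite exchange_big /=.
apply: (@le_trans _ _ (\sum_(r < N) C * (r.+1%:R * (s / p) ^+ r))); last first.
  rewrite -mulr_sumr ler_wpM2l // sum_arith_geom_le //.
    by rewrite divr_ge0 // ltW.
  by rewrite ltr_pdivrMr ?mul1r.
apply: ler_sum => r _.
rewrite -big_mkcond big_const_seq iter_addr_0 -[_ *+ _]mulr_natl.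
rewrite expr_div_n [leRHS](_ : _ = C * s ^+ r * b r); last by rewrite /b; ring.
rewrite ler_wpM2r //; apply: le_trans (aC r); rewrite ler_nat.
rewrite -size_filter; apply: uniq_leq_size => [|g].
  exact: filter_uniq (fset_uniq _).
rewrite mem_filter => /andP[gr gX]; rewrite in_fset_set.
  apply/mem_set; split; last exact: mem_fball.
  by apply: XA; move: gX; rewrite in_fset_set // => /set_mem.
exact: finite_setIr (fball_finite d r).
Qed.

(** * Summability of the kernel along the chosen end *)

Theorem proposition1p1 (R : realType) (d : nat) (hd : (2 <= d)%N)
    (A : set (free_group d))
    (hA : (upper_growth R A < (Num.sqrt ((2 * d - 1)%N%:R : R))%:E)%E) :
  mu_light (@srw R d) A.
Proof.
have d0 : (0 < d)%N by apply: leq_trans hd.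
set q : R := (2 * d - 1)%:R in hA; set p := Num.sqrt q in hA.
have q0 : 0 < q by rewrite ltr0n; lia.
have p0 : 0 < p by rewrite sqrtr_gt0.
have pE : p ^+ 2 = q by rewrite sqr_sqrtr // ltW.
have fin0 := potential_nil_esum p0 hA.
have [xi [rxi sxi xiS xi_le]] := exists_ray d0 p0 pE fin0.
have xixi m n : (m <= n)%N -> suffix (xi m) (xi n).
  elim: n => [|n IHn]; first by rewrite leqn0 => /eqP ->; exact: suffix_refl.
  rewrite leq_eqVlt ltnS => /predU1P[->|/IHn mn]; first exact: suffix_refl.
  exact: suffix_trans (xiS n).
exists (fun g => kernel q (xi (size (val g))) (val g)); split.
- by move=> g; rewrite divr_gt0 // exprn_gt0.
- exact: kernel_harmonic.
pose M := fine (\esum_(g in A) (potential p [::] (val g))%:E)%E.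
have pot0 w g : 0 <= potential p w g by exact/potential_ge0/ltW.
have sumM n (X : set (free_group d)) : finite_set X -> X `<=` A ->
    \sum_(g <- fset_set X) potential p (xi n) (val g) <= M.
  move=> Xfin XA; rewrite -lee_fin /M fineK; last first.
    by rewrite ge0_fin_numE // esum_ge0 // => g _; rewrite lee_fin.
  apply: le_trans (xi_le n); apply: esum_ge; exists X => //.
  by rewrite fsbig_finite // sumEFin.
have M0 : 0 <= M.
  by apply: le_trans (sumM 0 set0 _ _) => //; exact: sumr_ge0.
have potM n g : A g -> potential p (xi n) (val g) <= M.
  move=> Ag; have := sumM n [set g] (finite_set1 g).
  by rewrite fset_set1 big_seq_fset1; apply=> h ->.
(* The kernel is k^2 with k at most the potential. One factor is bounded by [M], as a single term of
   the sum; the other is summed over [X], again to at most [M]. *)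
apply: (@le_lt_trans _ _ (M * M)%:E); last exact: ltry.
apply: ge_ereal_sup => _ [X [Xfin XA] <-].
rewrite fsbig_finite // sumEFin lee_fin.
(* One word [xi N] is long enough for every element of [X]. *)
pose N := \max_(g <- fset_set X) size (val g).
apply: le_trans (ler_wpM2l M0 (sumM N X Xfin XA)).
rewrite mulr_sumr big_seq [leRHS]big_seq; apply: ler_sum => g gX.
have gN : (size (val g) <= N)%N.
  by rewrite (leq_bigmax_seq (F := fun g => size (val g)) g).
have Ag : A g by apply: XA; move: gX; rewrite in_fset_set // => /set_mem.
rewrite /kernel -(common_suffix_stable (xixi _ _ gN)) ?sxi //.
set c := common_suffix _ _.
pose k := p ^+ (2 * c) / p ^+ size (val g).
have k0 : 0 <= k by rewrite divr_ge0 // exprn_ge0 // ltW.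
have -> : q ^+ (2 * c) / q ^+ size (val g) = k * k.
  by rewrite -expr2 expr_div_n -!exprM ![(_ * 2)%N]mulnC !exprM pE.
have kpot : k <= potential p (xi N) (val g).
  by rewrite ler_peMr //; case: ifP; rewrite // ler1n.
by apply: ler_pM => //; apply: le_trans kpot (potM _ _ Ag).
Qed.
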